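(* Let $K$ be a commutative ring, let $A$ be a (not necessarily associative) $K$-algebra, and let $A=\bigoplus_{g\in G}A_g$ be a grading of $A$ by an abelian group $(G,+)$ that satisfies the permutation-contraction property. If the support $X=\{g\in G\mid A_g\neq\{0\}\}$ is arithmetically-free, then for every $s\in\mathbb{N}$, $$A^{1+\delta(X)^s}\subseteq A^{(s)}.$$
   Context: $\mathbb{N}$ denotes the positive integers. A grading of $A$ by an abelian group $(G,+)$ is a decomposition $A=\bigoplus_{g\in G}A_g$ into $K$-submodules with $A_g\cdot A_h\subseteq A_{g+h}$ for all $g,h\in G$; elements of $\bigcup_g A_g$ are called homogeneous. Permutation-contraction property: for all homogeneous elements $a,b,c$ of $A$ there exist $\gamma\in K$ and $z\in\operatorname{Span}_K\{z_1\cdot z_2\mid z_1,z_2\in\operatorname{alg}(b,c)\}$ such that $(a\cdot b)\cdot c=\gamma\,(a\cdot c)\cdot b+a\cdot z$. Here $\operatorname{alg}(b,c)$ is the subalgebra of $A$ generated by $b$ and $c$. Series: $A^1=A=A^{(0)}$, $A^{n+1}=A^n\cdot A$ and $A^{(n)}=A^{(n-1)}\cdot A^{(n-1)}$ for $n\in\mathbb{N}$, where the product of two submodules is the $K$-span of the products of their elements. Arithmetically-free: for a subset $X$ of an abelian group $(G,+)$ put $P_G(X)=\{g\in G\mid\exists x\in X: x+\langle g\rangle\subseteq X\}$. A finite subset $X$ of $G$ is arithmetically-free iff $X\cap P_G(X)=\emptyset$. For an arithmetically-free non-empty $X\subseteq G$, $\delta(X)$ is the minimal $\delta\in\{1,\ldots,|X|\}$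 such that for all $a,b_1,\ldots,b_\delta\in X$ there is $I\subseteq\{1,\ldots,\delta\}$ with $a+\sum_{i\in I}b_i\in G\setminus X$ (such a $\delta$ always exists). (If $X=\emptyset$, put $\delta(X)=1$.) *)

(* Defs.v *)
From mathcomp Require Import all_boot all_algebra.
From mathcomp Require Import finmap all_classical.

Set Implicit Arguments.
Unset Strict Implicit.
Unset Printing Implicit Defensive.

Import GRing.Theory.
Local Open Scope classical_set_scope.
Local Open Scope ring_scope.

(* A K-algebra, not necessarily associative, commutative or unital, is a
   K-module A with a K-bilinear multiplication mul. Rings are of type
   comPzRingType so as not to exclude the zero ring. *)
Definition bilinear_mul (K : comPzRingType) (A : lmodType K)
    (mul : A -> A -> A) : Prop :=
  (forall x, linear (mul x)) /\ (forall y, linear (mul^~ y)).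

Section Algebra.
Context (K : comPzRingType) (A : lmodType K) (mul : A -> A -> A).
Implicit Types S T : set A.

Definition submodule S : Prop := submod_closed (mem S).

Definition subalgebra S : Prop :=
  submodule S /\ (forall x y, S x -> S y -> S (mul x y)).

Definition lspan S : set A := smallest submodule S.

Definition alg S : set A := smallest subalgebra S.

Definition prod_submodule S T : set A :=
  lspan [set mul x y | x in S & y in T].

(* lower_power n is A^n; only n >= 1 is meaningful (A^1 = A). *)
Definition lower_power (n : nat) : set A :=
  iter n.-1 (fun S => prod_submodule S [set: A]) [set: A].

(* derived_power n is A^(n), with A^(0) = A. *)
Definition derived_power (n : nat) : set A :=
  iter n (fun S => prod_submodule S S) [set: A].

Section Grading.
Context (G : zmodType) (Agr : G -> set A).

(* Every element is, in a unique way, a sum of finitely many nonzero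
   components. The explicit finiteness condition is needed because the
   finitely-supported sum is 0 on families of infinite support. *)
Definition direct_sum_decomposition : Prop :=
  forall a : A, exists! f : G -> A,
    [/\ forall g, Agr g (f g),
        finite_set [set g | f g != 0]
      & a = \sum_(g \in [set: G]) f g].

Definition grading : Prop :=
  [/\ forall g, submodule (Agr g),
      direct_sum_decomposition
    & forall g h x y, Agr g x -> Agr h y -> Agr (g + h) (mul x y)].

Definition homogeneous : set A := \bigcup_(g in [set: G]) Agr g.

Definition grading_support : set G := [set g | Agr g <> [set 0]].

Definition permutation_contraction : Prop :=
  forall a b c, homogeneous a -> homogeneous b -> homogeneous c ->
    exists (gamma : K) (z : A),
      prod_submodule (alg [set b; c]) (alg [set b; c]) z /\
      mul (mul a b) c = gamma *: mul (mul a c) b + mul a z.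

End Grading.
End Algebra.

Section ArithmeticallyFree.
Context (G : zmodType).
Implicit Types X : set G.

Definition cyclic_subgroup (g : G) : set G := range (fun n : int => g *~ n).

Definition periods X : set G :=
  [set g | exists2 x, X x & [set x + h | h in cyclic_subgroup g] `<=` X].

Definition arithmetically_free X : Prop :=
  finite_set X /\ X `&` periods X = set0.

Definition escapes X (d : nat) : Prop :=
  forall (a : G) (b : 'I_d -> G), X a -> (forall i, X (b i)) ->
    exists I : {set 'I_d}, ~ X (a + \sum_(i in I) b i).

Definition delta_candidates X : set nat :=
  [set d | (1 <= d <= #|` fset_set X|)%N /\ escapes X d].

(* The minimum of delta_candidates X. If X is empty there is no candidate, and
   the default value 1 is the convention delta(X) = 1. *)
Definition delta X : nat :=
  xget 1%N [set d | delta_candidates X d /\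
                    forall e, delta_candidates X e -> (d <= e)%N].

End ArithmeticallyFree.

(* Main.v *)
Require Import Defs.
From mathcomp Require Import all_boot all_algebra.
From mathcomp Require Import finmap all_classical.

(* Write d = delta X, L_m = A^m and B_t = A^(t); put W = R (B B) for a right-stable
   graded R and a graded subalgebra B. The permutation-contraction property gives
   W B <= W, and lets two neighbouring factors of a word r b_1 ... b_d (r in R,
   b_i in B) be exchanged up to a scalar and an error in W. Moving to the front
   the factors b_i for which deg r + sum deg b_i leaves X makes the word vanish,
   so R B ... B <= R (B B) with d factors B. Iterating, L_(m + d^t) <= L_m B_t.
   For d >= 2 the exponent 1 + d^(s+1) is at least (1 + d^s) + d^s, so induction
   gives L_(1 + d^(s+1)) <= L_(1 + d^s) B_s <= B_s B_s; for d = 1, A A = 0. *)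

Set Implicit Arguments.
Unset Strict Implicit.
Unset Printing Implicit Defensive.

Import GRing.Theory.
Local Open Scope classical_set_scope.
Local Open Scope ring_scope.

(** * Escaping an arithmetically-free set by subset sums *)

Section Escape.
Context (G : zmodType).
Implicit Types (X : set G) (T : {fset G}).

(** Translation by [b] is injective and [T] is finite, so T + b inside T forces equality, and [T] is
    stable under subtracting [b] too. *)
Lemma fset_add_stable_cycle T (b : G) :
  (forall t, t \in T -> t + b \in T) ->
  forall x (n : int), x \in T -> x + b *~ n \in T.
Proof.
move=> Tb.
have Tadd : [fset (t + b)%R | t in T]%fset = T.
  apply/eqP; rewrite eqEfcard; apply/andP; split.
    by apply/fsubsetP => _ /imfsetP[t /= tT ->]; exact: Tb.
  by rewrite card_imfset //; exact: addIr.
have Tsub t : t \in T -> t - b \in T.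
  by rewrite -{1}Tadd => /imfsetP[u /= uT ->]; rewrite addrK.
move=> x n xT; case: n => n; last rewrite NegzE mulrNz.
  rewrite -pmulrn; elim: n => [|n IHn]; first by rewrite mulr0n addr0.
  by rewrite mulrSr addrA Tb.
rewrite -pmulrn; elim: n.+1 => [|m IHm]; first by rewrite mulr0n subr0.
by rewrite mulrSr opprD addrA Tsub.
Qed.

(* Passing from b :: l to l replaces T by T u (T + b), which is strictly larger:
   otherwise T + <b> = T would be contained in X, making b a period of X. *)
Lemma subset_sums_growth X (l : seq G) T :
  arithmetically_free X -> T != fset0 -> (forall b, b \in l -> X b) ->
  (forall t m, t \in T -> size m = size l -> X (t + \sum_(x <- mask m l) x)) ->
  (#|` T| + size l <= #|` fset_set X|)%N.
Proof.
move=> [finX freeX].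
elim: l T => [|b l IHl] T T0 Xl XT.
  rewrite addn0; apply: fsubset_leq_card; apply/fsubsetP => t tT.
  rewrite in_fset_set // inE.
  by have := XT t [::] tT erefl; rewrite big_nil addr0.
pose Tb := [fset (t + b)%R | t in T]%fset.
(* Masks that skip or take [b] carry the hypothesis over to [T] and to [Tb] respectively. *)
have XTl t m : t \in T -> size m = size l -> X (t + \sum_(x <- mask m l) x).
  by move=> tT sm; apply: (XT t (false :: m)) => //=; rewrite sm.
have XTbl t m : t \in T -> size m = size l ->
    X (t + b + \sum_(x <- mask m l) x).
  move=> tT sm; have := XT t (true :: m) tT.
  by rewrite /= sm big_cons addrA; apply.
have prop : (T `<` T `|` Tb)%fset.
  rewrite fproperEneq fsubsetUl andbT eq_sym; apply/eqP => TE.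
  have Tstab t : t \in T -> t + b \in T.
    move=> tT; rewrite -TE inE; apply/orP; right.
    by apply/imfsetP; exists t.
  have /fset0Pn[x xT] := T0.
  have Xmem t : t \in T -> X t.
    move=> tT; have := XTl t (nseq (size l) false) tT.
    by rewrite size_nseq mask_false big_nil addr0; apply.
  suff : (X `&` periods X) b by rewrite freeX.
  split; first by apply: Xl; rewrite mem_head.
  exists x; first exact: Xmem.
  move=> _ [_ [n _ <-] <-]; apply: Xmem.
  exact: fset_add_stable_cycle.
rewrite addnS -addSn; apply: leq_trans (IHl (T `|` Tb)%fset _ _ _).
- by rewrite leq_add2r; exact: fproper_ltn_card.
- by apply: contraNneq T0 => /eqP; rewrite fsetU_eq0 => /andP[].
- by move=> c cl; apply: Xl; rewrite inE cl orbT.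
- move=> t m; rewrite inE => /orP[tT|/imfsetP[u /= uT ->]] sm.
    exact: XTl.
  exact: XTbl.
Qed.

(** If no subset sum left [X], growth from the singleton of [a] along all the [b i] would give 1 +
    |X| <= |X|. *)
Lemma escapes_card X :
  arithmetically_free X -> escapes X #|` fset_set X|.
Proof.
move=> freeX a b Xa Xb; apply: contrapT => noI.
have XI (I : {set _}) : X (a + \sum_(i in I) b i).
  by apply: contrapT => nX; apply: noI; exists I.
pose e := enum 'I_#|` fset_set X|.
have := @subset_sums_growth X (map b e) [fset a]%fset freeX.
rewrite cardfs1 size_map size_enum_ord add1n ltnn => nX.
suff : false by []; apply: nX.
- by apply/fset0Pn; exists a; rewrite inE.
- by move=> _ /mapP[i _ ->].
- move=> t m; rewrite inE => /eqP-> sm.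
  rewrite -map_mask big_map big_uniq ?mask_uniq ?enum_uniq //=.
  rewrite (eq_bigl (fun i => i \in [set j in mask m e])%SET); first exact: XI.
  by move=> i; rewrite inE.
Qed.

Lemma delta_spec X :
  arithmetically_free X -> (0 < delta X)%N /\ escapes X (delta X).
Proof.
move=> freeX; rewrite /delta; case: xgetP => [d _ [[/andP[d0 _] Xd] _]//|noC].
(* Without a minimum the default 1 is taken: for empty [X] there is no [a] to test, and otherwise
   |X| is a candidate, so a least one exists. *)
split=> //; case: (eqVneq (fset_set X) fset0) => [X0|X0].
  have finX : finite_set X by case: freeX.
  move=> a b Xa; have : a \in fset_set X by rewrite in_fset_set ?inE.
  by rewrite X0.
have cand : exists d, `[< delta_candidates X d >].
  exists #|` fset_set X|; apply/asboolP; split; last exact: escapes_card.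
  by rewrite leqnn andbT cardfs_gt0.
have [d /asboolP Xd dmin] := find_ex_minn cand.
by case: (noC d); split=> // e Xe; apply: dmin; exact/asboolP.
Qed.

End Escape.

(** * Spans, products of submodules and the two series *)

Section Products.
Context (K : comPzRingType) (A : lmodType K) (mul : A -> A -> A).
Context (mul_bilinear : bilinear_mul mul).
Implicit Types (S T U V W B R : set A) (x y z : A) (l : seq A).

Notation prod := (prod_submodule mul).

Lemma mulDZr x (a : K) y z : mul x (a *: y + z) = a *: mul x y + mul x z.
Proof. by case: mul_bilinear => + _; exact. Qed.

Lemma mulDZl x (a : K) y z : mul (a *: y + z) x = a *: mul y x + mul z x.
Proof. by case: mul_bilinear => _ /(_ x); exact. Qed.

Lemma mul_r0 x : mul x 0 = 0.
Proof. by have := mulDZr x (-1) 0 0; rewrite scaler0 addr0 scaleN1r addNr. Qed.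

Lemma mul_0r x : mul 0 x = 0.
Proof. by have := mulDZl x (-1) 0 0; rewrite scaler0 addr0 scaleN1r addNr. Qed.

Lemma submoduleP S :
  submodule S <->
  S 0 /\ (forall (a : K) x y, S x -> S y -> S (a *: x + y)).
Proof.
split=> [[S0 SD]|[S0 SD]]; split.
- by move: S0; rewrite inE.
- by move=> a x y Sx Sy; have := SD a x y; rewrite !inE; apply.
- by rewrite inE.
- by move=> a x y; rewrite !inE; exact: SD.
Qed.

Lemma submoduleT : submodule [set: A].
Proof. exact/submoduleP. Qed.

Lemma lspan_submodule S : submodule (lspan S).
Proof.
apply/submoduleP; split=> [T [Tsub _]|a x y Sx Sy T TP].
  by case/submoduleP: Tsub.
by case/submoduleP: (TP.1) => _; apply; [exact: Sx | exact: Sy].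
Qed.

Lemma lspan_min S T : submodule T -> S `<=` T -> lspan S `<=` T.
Proof. exact: smallest_sub. Qed.

Lemma sub_lspan S : S `<=` lspan S.
Proof. exact: sub_gen_smallest. Qed.

(** For a fixed factor, the other factors whose product lies in [W] form a submodule; this is used
    on each side in turn. *)
Lemma lspan_mul_ind W S T x y :
  submodule W -> (forall s t, S s -> T t -> W (mul s t)) ->
  lspan S x -> lspan T y -> W (mul x y).
Proof.
move=> /submoduleP[W0 WD] WST; move: x y.
have WSy s y : S s -> lspan T y -> W (mul s y).
  move=> Ss; move: y; apply: (@lspan_min _ (fun y => W (mul s y))) => [|t Tt].
    apply/submoduleP; split=> [|a u v Wu Wv]; first by rewrite mul_r0.
    by rewrite mulDZr; exact: WD.
  exact: WST.
move=> x y Sx Ty; move: x Sx.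
apply: (@lspan_min _ (fun x => W (mul x y))) => [|s Ss]; last exact: WSy.
apply/submoduleP; split=> [|a u v Wu Wv]; first by rewrite mul_0r.
by rewrite mulDZl; exact: WD.
Qed.

Lemma prod_mem S T x y : S x -> T y -> prod S T (mul x y).
Proof. by move=> Sx Ty; apply: sub_lspan; exists x => //; exists y. Qed.

Lemma prod_min S T W :
  submodule W -> (forall x y, S x -> T y -> W (mul x y)) -> prod S T `<=` W.
Proof. by move=> Wsub WST; apply: lspan_min => // _ [x Sx [y Ty <-]]; exact: WST. Qed.

Lemma prodS S S' T T' : S `<=` S' -> T `<=` T' -> prod S T `<=` prod S' T'.
Proof.
move=> SS TT; apply: prod_min => [|x y /SS ? /TT ?]; first exact: lspan_submodule.
exact: prod_mem.
Qed.

Lemma word_linear l (a : K) x y :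
  foldl mul (a *: x + y) l = a *: foldl mul x l + foldl mul y l.
Proof. by elim: l x y => //= z l IHl x y; rewrite mulDZl IHl. Qed.

(** The iterated product is spanned by left-normed words in the generators; each induction step
    absorbs the first letter into the generators of [S]. *)
Lemma iter_prod_words d S S0 B0 W B :
  submodule W -> S `<=` lspan S0 -> B `<=` lspan B0 ->
  (forall r l, S0 r -> size l = d -> (forall b, b \in l -> B0 b) ->
    W (foldl mul r l)) ->
  iter d (fun U => prod U B) S `<=` W.
Proof.
move=> Wsub; elim: d S S0 => [|d IHd] S S0 SS0 BB0 WS.
  by apply: subset_trans SS0 _; apply: lspan_min => // r Sr; exact: (WS r [::]).
rewrite iterSr; apply: (IHd _ [set mul x y | x in S0 & y in B0]) => //.
  apply: prod_min => [|x y /SS0 Sx /BB0 By]; first exact: lspan_submodule.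
  move: Sx By; apply: lspan_mul_ind; first exact: lspan_submodule.
  by move=> s t Ss Bt; apply: sub_lspan; exists s => //; exists t.
move=> _ l [s Ss [t Bt <-]] sl Bl; apply: (WS s (t :: l)) => //=; first by rewrite sl.
by move=> b; rewrite inE => /orP[/eqP->|/Bl].
Qed.

Lemma lower_powerS n :
  lower_power mul n.+2 = prod (lower_power mul n.+1) [set: A].
Proof. by []. Qed.

Lemma derived_powerS n :
  derived_power mul n.+1 = prod (derived_power mul n) (derived_power mul n).
Proof. by []. Qed.

Lemma lower_power_antitone m n :
  lower_power mul (m + n).+1 `<=` lower_power mul m.+1.
Proof.
have step k : lower_power mul k.+2 `<=` lower_power mul k.+1.
  by elim: k => [//|k IHk]; rewrite 2!lower_powerS; exact: prodS.
elim: n => [|n IHn]; first by rewrite addn0.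
by apply: subset_trans IHn; rewrite addnS; exact: step.
Qed.

Lemma lower_power_mulr m x y :
  lower_power mul m.+1 x -> lower_power mul m.+1 (mul x y).
Proof.
by move=> Lx; apply: (@lower_power_antitone m 1); rewrite addn1; exact: prod_mem.
Qed.

(** B_(n+1) = B_n B_n lies in the subalgebra B_n, so products of elements of B_(n+1) lie in B_n B_n
    again. *)
Lemma derived_power_subalgebra n : subalgebra mul (derived_power mul n).
Proof.
split; first by case: n => [|n]; [exact: submoduleT | exact: lspan_submodule].
elim: n => [//|n IHn] x y Dx Dy.
have DS : derived_power mul n.+1 `<=` derived_power mul n.
  apply: prod_min => //.
  by case: n {IHn Dx Dy} => [|n]; [exact: submoduleT | exact: lspan_submodule].
by apply: prod_mem; exact: DS.
Qed.

(** * Homogeneous generators and vanishing words *)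

Section Graded.
Context (G : zmodType) (Agr : G -> set A).
Context (Agr_grading : grading mul Agr).

Notation hom := (homogeneous Agr).

(** Stated through spanning, so that multilinear claims need checking on homogeneous elements
    only. *)
Definition graded S := S `<=` lspan (S `&` hom).

Lemma homogeneous_mul x y : hom x -> hom y -> hom (mul x y).
Proof.
by move=> [g _ gx] [h _ hy]; exists (g + h) => //; case: Agr_grading => _ _; apply.
Qed.

Lemma gradedT : graded [set: A].
Proof.
move=> a _; case: Agr_grading => _ /(_ a)[f [[Af finf ->] _]] _.
rewrite setTI; have /submoduleP[H0 HD] := lspan_submodule hom.
rewrite fsbig_supp fsbig_finite /=.
  apply: (big_ind _ H0) => [x y Hx Hy|g _].
    by rewrite -[x]scale1r; exact: HD.
  by apply: sub_lspan; exists g.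
by apply: sub_finite_set finf => g [_ /eqP].
Qed.

Lemma prod_graded S T : graded S -> graded T -> graded (prod S T).
Proof.
move=> gS gT; apply: prod_min => [|x y /gS Sx /gT Ty]; first exact: lspan_submodule.
apply: lspan_mul_ind Sx Ty; first exact: lspan_submodule.
move=> s t [Ss hs] [Tt ht]; apply: sub_lspan; split; first exact: prod_mem.
exact: homogeneous_mul.
Qed.

Lemma lower_power_graded m : graded (lower_power mul m.+1).
Proof.
by elim: m => [|m IHm]; [exact: gradedT | apply: prod_graded => //; exact: gradedT].
Qed.

Lemma derived_power_graded n : graded (derived_power mul n).
Proof. by elim: n => [|n IHn]; [exact: gradedT | exact: prod_graded]. Qed.

Lemma word_degree (I : Type) (g : G) (h : I -> G) r (b : I -> A) (e : seq I) :
  Agr g r -> (forall i, Agr (h i) (b i)) ->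
  Agr (g + \sum_(i <- e) h i) (foldl mul r (map b e)).
Proof.
move=> gr hb; elim: e g r gr => [|i e IHe] g r gr /=.
  by rewrite big_nil addr0.
rewrite big_cons addrA; apply: IHe.
by case: Agr_grading => _ _; apply.
Qed.

Lemma notin_support_eq0 g x : ~ grading_support Agr g -> Agr g x -> x = 0.
Proof. by move=> /contrapT ->. Qed.

Lemma word_eq0 d r (b : 'I_d -> A) :
  escapes (grading_support Agr) d -> hom r -> (forall i, hom (b i)) ->
  exists I : {set 'I_d}, foldl mul r (map b (enum I)) = 0.
Proof.
move=> esc [g _ gr] hb.
have /choice[h hbi] : forall i, exists g, Agr g (b i).
  by move=> i; case: (hb i) => k; exists k.
(* A degree outside the support kills its letter: the empty subset serves when [r] is zero, a
   singleton when some [b i] is. *)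
have [Xg|Xg] := pselect (grading_support Agr g); last first.
  exists (finset.set0); rewrite enum_set0 /=; exact: notin_support_eq0 gr.
have [Xh|/existsNP[i Xi]] := pselect (forall i, grading_support Agr (h i)); last first.
  exists (finset.set1 i); rewrite enum_set1 /= (notin_support_eq0 Xi (hbi i)).
  exact: mul_r0.
have [I XI] := esc g h Xg Xh; exists I.
apply: notin_support_eq0 XI _; rewrite -big_enum; exact: word_degree.
Qed.

Context (Agr_pc : permutation_contraction mul Agr).

(** * Collapsing d right factors B into one factor B B *)

Section Collapse.
Context (R B : set A).
Context (R_graded : graded R) (B_graded : graded B).
Context (R_mulr : forall x y, R x -> R (mul x y)).
Context (B_subalgebra : subalgebra mul B).

Let W := prod R (prod B B).

(** The subalgebra [B] contains the algebra generated by [b] and [c], so the error [z] falls into B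
    B. *)
Lemma collapse_swap r b c : R r -> hom r -> B b -> hom b -> B c -> hom c ->
  exists gamma z, prod B B z /\
    mul (mul r b) c = gamma *: mul (mul r c) b + mul r z.
Proof.
move=> Rr hr Bb hb Bc hc.
have [gamma [z [zP ->]]] := Agr_pc hr hb hc.
exists gamma, z; split=> //; apply: prodS zP; apply: smallest_sub => //.
- by move=> _ [] ->.
- by move=> _ [] ->.
Qed.

Let W_submodule : submodule W. Proof. exact: lspan_submodule. Qed.

Lemma collapse_mulr w b : W w -> B b -> W (mul w b).
Proof.
have /submoduleP[_ WD] := W_submodule.
have BBB : prod B B `<=` B by apply: prod_min; case: B_subalgebra.
have Wspan : W `<=` lspan [set mul r c | r in R `&` hom & c in prod B B `&` hom].
  apply: prod_min => [|x y /R_graded Rx /prod_graded BBy]; first exact: lspan_submodule.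
  apply: lspan_mul_ind Rx (BBy _ _) => // [|s t Rs Bt]; first exact: lspan_submodule.
  by apply: sub_lspan; exists s => //; exists t.
move=> /Wspan Ww /B_graded Bb; move: Ww Bb.
apply: lspan_mul_ind => // _ c [r [Rr hr] [y [BBy hy] <-]] [Bc hc].
(* The exchange turns (r y) c into a multiple of (r c) y plus r z; both lie in [W], since r c is in
   [R] and [y], [z] are in B B. *)
have [gamma [z [BBz ->]]] := collapse_swap Rr hr (BBB _ BBy) hy Bc hc.
by apply: WD; apply: prod_mem => //; exact: R_mulr.
Qed.

Let good l := forall b, b \in l -> B b /\ hom b.

Lemma collapse_word w l : W w -> good l -> W (foldl mul w l).
Proof.
elim: l w => //= b l IHl w Ww gl; apply: IHl.
  by apply: collapse_mulr => //; case: (gl b); rewrite ?mem_head.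
by move=> c cl; apply: gl; rewrite inE cl orbT.
Qed.

Lemma collapse_front x l1 l2 r : R r -> hom r -> good (x :: l1 ++ l2) ->
  W (foldl mul r (x :: l1 ++ l2)) -> W (foldl mul r (l1 ++ x :: l2)).
Proof.
have /submoduleP[W0 WD] := W_submodule.
elim: l1 r => //= y l1 IHl r Rr hr gl Wr.
have [Bx hx] : B x /\ hom x by apply: gl; rewrite mem_head.
have [By hy] : B y /\ hom y by apply: gl; rewrite !inE eqxx orbT.
have gl' : good (l1 ++ l2) by move=> b bl; apply: gl; rewrite !inE bl !orbT.
apply: IHl; [exact: R_mulr | exact: homogeneous_mul | | ].
  by move=> b; rewrite inE => /predU1P[->//|/gl'].
(* What results is a multiple of the word beginning with [x], plus a word that begins with r z in
   [W] and so stays in [W]. *)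
have [gamma [z [BBz /= ->]]] := collapse_swap Rr hr By hy Bx hx.
rewrite word_linear; apply: WD => //.
by apply: collapse_word => //; exact: prod_mem.
Qed.

(** By induction on [l']: its first letter is brought to the front of [l] and absorbed into [r],
    which stays in [R]. *)
Lemma collapse_perm l' l r : R r -> hom r -> good l ->
  perm_eq l' l -> W (foldl mul r l') -> W (foldl mul r l).
Proof.
elim: l' l r => [|x l' IHl] l r Rr hr gl pl Wr.
  by have := perm_size pl; case: l {gl pl}.
have xl : x \in l by rewrite -(perm_mem pl) mem_head.
case: (path.splitPr xl) gl pl => l1 l2 gl.
rewrite perm_sym -cat1s perm_catCA /= perm_cons perm_sym => pl.
have gl' : good (x :: l1 ++ l2).
  by move=> b bl; apply: gl; move: bl; rewrite !(inE, mem_cat) orbCA.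
apply: collapse_front => //=; apply: IHl => //.
- exact: R_mulr.
- by apply: homogeneous_mul => //; case: (gl' x); rewrite ?mem_head.
- by move=> b bl; apply: gl'; rewrite inE bl orbT.
Qed.

Lemma prod_collapse d : escapes (grading_support Agr) d ->
  iter d (fun U => prod U B) R `<=` W.
Proof.
have /submoduleP[W0 _] := W_submodule.
move=> esc; apply: iter_prod_words R_graded B_graded _ => // r l [Rr hr] sl gl.
move: esc; rewrite -sl => esc.
have hl (i : 'I_(size l)) : hom (tnth (in_tuple l) i).
  by case: (gl _ (mem_tnth i (in_tuple l))).
have [I rI0] := word_eq0 esc hr hl.
(* The letters indexed by [I] go first; their prefix vanishes, and the rest of the word starts from
   0, which lies in [W]. *)
apply: (@collapse_perm (map (tnth (in_tuple l)) (enum I ++ enum (~: I)%SET))) => //.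
  rewrite -[X in perm_eq _ X](map_tnth_enum (in_tuple l)); apply: perm_map.
  apply: uniq_perm => [| |i]; rewrite ?enum_uniq //.
    rewrite cat_uniq !enum_uniq andbT /=; apply/hasPn => i.
    by rewrite !mem_enum inE.
  by rewrite mem_cat !mem_enum !inE orbN.
rewrite map_cat foldl_cat rI0; apply: collapse_word => // b /mapP[i _ ->].
exact/gl/mem_tnth.
Qed.

End Collapse.

(** * Comparison of the lower and derived series *)

Lemma lower_power_collapse d t m : escapes (grading_support Agr) d ->
  lower_power mul (m + d ^ t).+1 `<=`
  prod (lower_power mul m.+1) (derived_power mul t).
Proof.
move=> esc; elim: t m => [|t IHt] m; first by rewrite expn0 addn1.
(* The exponent d^t is split off k times; k = d leaves d factors B_t, which [prod_collapse] merges
   into B_t B_t = B_(t+1). *)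
have IHk k : lower_power mul (m + k * d ^ t).+1 `<=`
    iter k (fun U => prod U (derived_power mul t)) (lower_power mul m.+1).
  elim: k => [|k IHk]; first by rewrite mul0n addn0.
  rewrite mulSnr addnA; apply: subset_trans (IHt _) _ => /=.
  exact: prodS.
rewrite expnS; apply: subset_trans (IHk d) _; apply: prod_collapse => //.
- exact: lower_power_graded.
- exact: derived_power_graded.
- by move=> x y; exact: lower_power_mulr.
- exact: derived_power_subalgebra.
Qed.

(** A one-element index set has only two subsets, so for homogeneous [s] and [t] the vanishing word
    is [s] or [mul s t]; either way the product is zero. *)
Lemma mul_eq0_escapes1 x y : escapes (grading_support Agr) 1 -> mul x y = 0.
Proof.
move=> esc; have z0 : submodule [set (0 : A)].
  by apply/submoduleP; split=> // a u v -> ->; rewrite scaler0 addr0.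
have Aspan z : lspan ([set: A] `&` hom) z by exact: gradedT.
move: (Aspan x) (Aspan y).
apply: (lspan_mul_ind z0) => s t [_ hs] [_ ht].
have [J] := word_eq0 (b := fun=> t) esc hs (fun=> ht).
case: (set_0Vmem J) => [->|[i iJ]].
  by rewrite enum_set0 /= => ->; exact: mul_0r.
have -> : J = finset.set1 i.
  by apply/finset.setP => j; rewrite [j]ord1 [i]ord1 !inE -[RHS]iJ [i]ord1.
by rewrite enum_set1.
Qed.

End Graded.

End Products.

Theorem proposition3p3 (K : comPzRingType) (A : lmodType K)
    (mul : A -> A -> A) (mul_bilinear : bilinear_mul mul)
    (G : zmodType) (Agr : G -> set A) (Agr_grading : grading mul Agr)
    (Agr_pc : permutation_contraction mul Agr)
    (supp_free : arithmetically_free (grading_support Agr))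
    (s : nat) (s_gt0 : (0 < s)%N) :
  lower_power mul (1 + delta (grading_support Agr) ^ s)%N
    `<=` derived_power mul s.
Proof.
have [d_gt0 esc] := delta_spec supp_free.
set d := delta _ in d_gt0 esc *.
have collapse := lower_power_collapse mul_bilinear Agr_grading Agr_pc.
elim: s s_gt0 => // s IHs _; rewrite derived_powerS.
(* For d = 1 the exponent is 2 whatever s is, so it cannot be split in two; instead all products
   vanish. *)
have [d1|d_neq1] := eqVneq d 1%N.
  rewrite d1 exp1n; apply: prod_min => [|x y _ _]; first exact: lspan_submodule.
  rewrite (mul_eq0_escapes1 mul_bilinear Agr_grading); last by rewrite -d1.
  by case/submoduleP: (lspan_submodule
       [set mul x y | x in derived_power mul s & y in derived_power mul s]).
have d_gt1 : (1 < d)%N by rewrite ltn_neqAle eq_sym d_neq1.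
have ds_le : (d ^ s + d ^ s <= d ^ s.+1)%N.
  by rewrite addnn -mul2n expnS leq_mul2r d_gt1 orbT.
(* The middle summand is the slack d^(s+1) - 2 d^s: the final d^s is collapsed, and
   [lower_power_antitone] drops the slack. *)
have -> : (1 + d ^ s.+1 = (d ^ s + (d ^ s.+1 - (d ^ s + d ^ s)) + d ^ s).+1)%N.
  by rewrite add1n addnAC subnKC.
apply: subset_trans (collapse _ _ _ esc) _; apply: prodS => //.
apply: subset_trans (@lower_power_antitone _ _ mul _ _) _.
(* The induction hypothesis starts at 1; for s = 0 the target A^(0) is all of [A]. *)
by case: s {ds_le} IHs => [//|s]; exact.
Qed.
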